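(* Let $A_G$ and $A'_G$ be strongly $G$-graded algebras over a field $\mathbb{F}$, and let $W_G$ and $W'_G$ be $G$-graded left modules over $A_G$ and $A'_G$ respectively. Then $$(A_G\otimes_{\mathbb{F}}A'_G)\otimes_{A_G\otimes^G_{\mathbb{F}}A'_G}(W_G\otimes^G_{\mathbb{F}}W'_G)\cong W_G\otimes_{\mathbb{F}}W'_G$$ as $A_G\otimes_{\mathbb{F}}A'_G$-modules.
   Context: Algebras are associative and unital. A $G$-graded $\mathbb{F}$-algebra is $A_G=\bigoplus_{g\in G}A_g$ with $A_gA_h\subseteq A_{gh}$; it is strongly graded if $A_gA_h=A_{gh}$ for all $g,h\in G$. A $G$-graded left $A_G$-module is $W_G=\bigoplus_gW_g$ with $A_gW_h\subseteq W_{gh}$. The graded product of algebras is the subalgebra $A_G\otimes^G_{\mathbb{F}}A'_G=\bigoplus_gA_g\otimes_{\mathbb{F}}A'_g$ of $A_G\otimes_{\mathbb{F}}A'_G$; the graded product of modules is $W_G\otimes^G_{\mathbb{F}}W'_G=\bigoplus_gW_g\otimes_{\mathbb{F}}W'_g\subseteq W_G\otimes_{\mathbb{F}}W'_G$, a left $A_G\otimes^G_{\mathbb{F}}A'_G$-module by $(a_g\otimes a'_g)(w_h\otimes w'_h)=a_gw_h\otimes a'_gw'_h$. $W_G\otimes_{\mathbb{F}}W'_G$ is an $A_G\otimes_{\mathbb{F}}A'_G$-module by $(a\otimes a')(w\otimes w')=aw\otimes a'w'$. *)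

(* Defs.v *)
From HB Require Import structures.
From mathcomp Require Import all_boot all_algebra.
From mathcomp Require Import boolp.
From mathcomp.multinomials Require Import freeg.

Set Implicit Arguments.
Unset Strict Implicit.
Unset Printing Implicit Defensive.

Import GRing.Theory.
Local Open Scope ring_scope.

Section ZSpan.
Variables (V : zmodType) (P : V -> Prop).

Inductive zspan : V -> Prop :=
| zspan0 : zspan 0
| zspan_gen x of P x : zspan x
| zspanB x y of zspan x & zspan y : zspan (x - y).

Lemma zspanN x : zspan x -> zspan (- x).
Proof. by move=> xP; rewrite -[- x]add0r; apply: zspanB => //; apply: zspan0. Qed.

Lemma zspanD x y : zspan x -> zspan y -> zspan (x + y).
Proof. by move=> xP yP; rewrite -[y]opprK; apply/zspanB/zspanN. Qed.

Definition zspanp : {pred V} := fun x => `[< zspan x >].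

Lemma zspanpP x : reflect (zspan x) (x \in zspanp).
Proof. exact: asboolP. Qed.

Lemma zspanp_closed : zmod_closed zspanp.
Proof.
split; first exact/zspanpP/zspan0.
by move=> x y /zspanpP xP /zspanpP yP; apply/zspanpP/zspanB.
Qed.

HB.instance Definition _ := GRing.isZmodClosed.Build V zspanp zspanp_closed.

End ZSpan.

(* Tensor product over a set S of scalars acting on the right of M by rM and *)
(* on the left of N by lN: the free abelian group on M * N modulo the        *)
(* relations of biadditivity and S-balancedness.                             *)
Section BalancedTensor.
Variables (S : Type) (M N : zmodType) (rM : M -> S -> M) (lN : S -> N -> N).

Inductive btens_rel : {freeg (M * N)%type} -> Prop :=
| btens_relDl x x' y :
    btens_rel (<< (x + x', y) >> - (<< (x, y) >> + << (x', y) >>))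
| btens_relDr x y y' :
    btens_rel (<< (x, y + y') >> - (<< (x, y) >> + << (x, y') >>))
| btens_relM x s y :
    btens_rel (<< (rM x s, y) >> - << (x, lN s y) >>).

Definition btens : Type := Quotient.quot (zspanp btens_rel).
HB.instance Definition _ := GRing.Zmodule.on btens.

Definition btens_pi (D : {freeg (M * N)%type}) : btens :=
  \pi_(Quotient.quot (zspanp btens_rel))%qT D.

Definition btens_repr (t : btens) : {freeg (M * N)%type} :=
  repr (t : Quotient.quot (zspanp btens_rel)).

Lemma btens_pi_zmod : zmod_morphism btens_pi.
Proof. move=> x y; rewrite /btens_pi; exact: raddfB. Qed.
HB.instance Definition _ := GRing.isZmodMorphism.Build _ _ btens_pi btens_pi_zmod.

Lemma btens_pi_surj (t : btens) : exists D, t = btens_pi D.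
Proof. by exists (btens_repr t); rewrite /btens_pi reprK. Qed.

Lemma btens_pi_eq D E : zspan btens_rel (D - E) -> btens_pi D = btens_pi E.
Proof. by move=> h; apply/eqP; rewrite -Quotient.idealrBE; apply/zspanpP. Qed.

Lemma btens_reprK D : zspan btens_rel (btens_repr (btens_pi D) - D).
Proof. by apply/zspanpP; rewrite Quotient.idealrBE /btens_pi reprK. Qed.

Definition btpure (x : M) (y : N) : btens := btens_pi << (x, y) >>.

Lemma btpureDl x x' y : btpure (x + x') y = btpure x y + btpure x' y.
Proof. by rewrite -raddfD; apply/btens_pi_eq/zspan_gen/btens_relDl. Qed.

Lemma btpureDr x y y' : btpure x (y + y') = btpure x y + btpure x y'.
Proof. by rewrite -raddfD; apply/btens_pi_eq/zspan_gen/btens_relDr. Qed.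

Lemma btpureM x s y : btpure (rM x s) y = btpure x (lN s y).
Proof. by apply/btens_pi_eq/zspan_gen/btens_relM. Qed.

Lemma btens_ind (P : btens -> Prop) :
  P 0 -> (forall x y, P (btpure x y)) ->
  (forall t u, P t -> P u -> P (t - u)) -> forall t, P t.
Proof.
move=> P0 Pp PB t.
have PN u : P u -> P (- u) by rewrite -[- u]add0r; apply: PB.
have PD u v : P u -> P v -> P (u + v).
  by move=> Pu Pv; rewrite -[v]opprK; apply: PB => //; apply: PN.
have [D ->] := btens_pi_surj t.
rewrite -[D]freeg_sumE raddf_sum; elim/big_ind: _ => // -[x y] _.
have -> : << coeff (x, y) D *g (x, y) >> = << (x, y) >> *~ coeff (x, y) D :> {freeg _}.
  by rewrite freegU_mulz intz.
rewrite raddfMz; case: (coeff _ _) => n.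
  by rewrite -pmulrn; elim: n => [|n IHn]; rewrite ?mulr0n // mulrS; apply: PD => //; apply: Pp.
rewrite NegzE mulrNz -pmulrn; apply: PN.
by elim: n.+1 => [|m IHm]; rewrite ?mulr0n // mulrS; apply: PD => //; apply: Pp.
Qed.

Section Lift.
Variables (Z : zmodType) (f : M -> N -> Z).

Definition balanced := [/\ forall x x' y, f (x + x') y = f x y + f x' y,
  forall x y y', f x (y + y') = f x y + f x y' &
  forall x s y, f (rM x s) y = f x (lN s y)].

Definition btlift (t : btens) : Z :=
  fglift (fun xy : M * N => f xy.1 xy.2 : zmodule Z) (btens_repr t).

Hypothesis f_bal : balanced.

Lemma btlift_pi D :
  btlift (btens_pi D) = fglift (fun xy : M * N => f xy.1 xy.2 : zmodule Z) D.
Proof.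
pose h : {freeg (M * N)%type} -> Z := fglift (fun xy : M * N => f xy.1 xy.2 : zmodule Z).
have hB x y : h (x - y) = h x - h y by apply: (@lift_is_additive int (M * N)%type (zmodule Z)).
have h1 x y : h << (x, y) >> = f x y by rewrite /h liftU scale1r.
have h0 : h 0 = 0 by rewrite -[X in h X](subrr 0) hB subrr.
have hD x y : h (x + y) = h x + h y.
  have hN : h (- y) = - h y by have := hB 0 y; rewrite h0 !sub0r.
  by have := hB x (- y); rewrite hN !opprK.
suff hs E : zspan btens_rel E -> h E = 0.
  change (h (btens_repr (btens_pi D)) = h D).
  by apply/eqP; rewrite -subr_eq0 -hB; apply/eqP; apply: hs; apply: btens_reprK.
have [fDl fDr fM] := f_bal.
elim=> [|_ [x x' y|x y y'|x s y]|u v _ hu _ hv] //.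
- by rewrite hB hD !h1 fDl subrr.
- by rewrite hB hD !h1 fDr subrr.
- by rewrite hB !h1 fM subrr.
- by rewrite hB hu hv subrr.
Qed.

Lemma btliftB : {morph btlift : t u / t - u}.
Proof.
move=> t u; have [D ->] := btens_pi_surj t; have [E ->] := btens_pi_surj u.
by rewrite -raddfB !btlift_pi; apply: (@lift_is_additive int (M * N)%type (zmodule Z)).
Qed.

Lemma btlift0 : btlift 0 = 0.
Proof. by rewrite -[X in btlift X](subrr 0) btliftB subrr. Qed.

Lemma btliftD : {morph btlift : t u / t + u}.
Proof.
move=> t u; have uN : btlift (- u) = - btlift u.
  by rewrite -[X in btlift X]add0r btliftB btlift0 add0r.
by rewrite -[X in btlift (_ + X)]opprK btliftB uN opprK.
Qed.

Lemma btliftE x y : btlift (btpure x y) = f x y.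
Proof. by rewrite btlift_pi liftU scale1r. Qed.

End Lift.

Lemma btlift_ext (Z : zmodType) (f g : M -> N -> Z) :
  (forall x y, f x y = g x y) -> btlift f =1 btlift g.
Proof. by move=> fg t; have -> // : f = g; apply/funext => x; apply/funext => y. Qed.

Lemma zmorph_ext (Z : zmodType) (f g : btens -> Z) :
  zmod_morphism f -> zmod_morphism g ->
  (forall x y, f (btpure x y) = g (btpure x y)) -> f =1 g.
Proof.
move=> fB gB fg; elim/btens_ind=> [|//|t u ft gu].
  by rewrite -(subrr 0) fB gB !subrr.
by rewrite fB gB ft gu.
Qed.

End BalancedTensor.

(* F-algebras, presented as rings with a morphism from F into their centre.  *)
(* The library's algType is not used because it excludes the zero algebra    *)
(* (see alg_of below for the comparison).                                    *)
HB.mixin Record isPzAlgebra (F : pzRingType) A of GRing.PzRing A := {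
  alg_map : {rmorphism F -> A};
  alg_mapC : forall (c : F) (a : A), alg_map c * a = a * alg_map c
}.
#[short(type="pzAlgType")]
HB.structure Definition PzAlgebra (F : pzRingType) :=
  {A of GRing.PzRing A & isPzAlgebra F A}.

Definition alg_of (F : pzRingType) (A : algType F) : Type := A.

Section AlgOf.
Variables (F : comPzRingType) (A : algType F).

HB.instance Definition _ := GRing.PzRing.on (alg_of A).

Lemma in_algC (c : F) (a : alg_of A) : in_alg A c * a = a * in_alg A c.
Proof. by rewrite mulr_algl mulr_algr. Qed.

HB.instance Definition _ := isPzAlgebra.Build F (alg_of A) in_algC.

End AlgOf.

(* An A-module seen as an F-module; the F-module A itself is restr A^o.      *)
Definition restr (F : pzRingType) (A : pzAlgType F) (W : lmodType A) : Type := W.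

Section Restr.
Variables (F : pzRingType) (A : pzAlgType F) (W : lmodType A).

HB.instance Definition _ := GRing.Zmodule.on (restr W).

Definition restr_scale (c : F) (w : restr W) : restr W :=
  (alg_map c : A) *: (w : W).

Fact restr_scaleA c d w : restr_scale c (restr_scale d w) = restr_scale (c * d) w.
Proof. by rewrite /restr_scale scalerA rmorphM. Qed.
Fact restr_scale1 : left_id 1 restr_scale.
Proof. by move=> w; rewrite /restr_scale rmorph1 scale1r. Qed.
Fact restr_scaleDr : right_distributive restr_scale +%R.
Proof. by move=> c v w; apply: scalerDr. Qed.
Fact restr_scaleDl w : {morph restr_scale^~ w : c d / c + d}.
Proof. by move=> c d; rewrite /restr_scale rmorphD; apply: scalerDl. Qed.

HB.instance Definition _ := GRing.Zmodule_isLmodule.Build F (restr W)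
  restr_scaleA restr_scale1 restr_scaleDr restr_scaleDl.

End Restr.

Definition tens (F : comPzRingType) (M N : lmodType F) : Type :=
  btens (fun (x : M) (c : F) => c *: x) (fun (c : F) (y : N) => c *: y).

HB.instance Definition _ (F : comPzRingType) (M N : lmodType F) :=
  GRing.Zmodule.on (tens M N).

(* W (x)_F W' for modules W and W' over F-algebras A and A'.                 *)
Definition mtens (F : comPzRingType) (A A' : pzAlgType F)
  (W : lmodType A) (W' : lmodType A') : Type := tens (restr W) (restr W').

HB.instance Definition _ (F : comPzRingType) (A A' : pzAlgType F)
    (W : lmodType A) (W' : lmodType A') :=
  GRing.Zmodule.on (mtens W W').

Definition mpure (F : comPzRingType) (A A' : pzAlgType F)
    (W : lmodType A) (W' : lmodType A') (w : W) (w' : W') : mtens W W' :=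
  btpure _ _ (w : restr W) (w' : restr W').

Definition atens (F : comPzRingType) (A A' : pzAlgType F) : Type :=
  mtens (A^o : lmodType A) (A'^o : lmodType A').

HB.instance Definition _ (F : comPzRingType) (A A' : pzAlgType F) :=
  GRing.Zmodule.on (atens A A').

Definition apure (F : comPzRingType) (A A' : pzAlgType F) (a : A) (a' : A') :
  atens A A' := mpure (a : A^o) (a' : A'^o).

Section TensorAction.
Variables (F : comPzRingType) (A A' : pzAlgType F).
Variables (W : lmodType A) (W' : lmodType A').

(* (a (x) a') (w (x) w') = a w (x) a' w'                                     *)
Definition tact1 (a : A) (a' : A') : mtens W W' -> mtens W W' :=
  btlift (fun (w : restr W) (w' : restr W') => mpure (a *: (w : W)) (a' *: (w' : W'))).

Definition tact (t : atens A A') (u : mtens W W') : mtens W W' :=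
  btlift (fun (a : restr A^o) (a' : restr A'^o) => tact1 a a' u) t.

Lemma mpureDl (w v : W) (w' : W') : mpure (w + v) w' = mpure w w' + mpure v w'.
Proof. exact: btpureDl. Qed.
Lemma mpureDr (w : W) (w' v' : W') : mpure w (w' + v') = mpure w w' + mpure w v'.
Proof. exact: btpureDr. Qed.
Lemma mpureM (c : F) (w : W) (w' : W') :
  mpure ((alg_map c : A) *: w) w' = mpure w ((alg_map c : A') *: w').
Proof. exact: (@btpureM F (restr W) (restr W') (fun x c => c *: x)). Qed.

Lemma mtens_ext (Z : zmodType) (f g : mtens W W' -> Z) :
  zmod_morphism f -> zmod_morphism g ->
  (forall w w', f (mpure w w') = g (mpure w w')) -> f =1 g.
Proof. exact: zmorph_ext. Qed.

Fact tact1_bal (a : A) (a' : A') : balanced (fun (w : restr W) (c : F) => c *: w)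
  (fun (c : F) (w' : restr W') => c *: w')
  (fun (w : restr W) (w' : restr W') => mpure (a *: (w : W)) (a' *: (w' : W'))).
Proof.
split=> [x x' y|x y y'|x c y].
- by rewrite -mpureDl -scalerDr.
- by rewrite -mpureDr -scalerDr.
- rewrite [c *: x]/(alg_map c *: (x : W)) [c *: y]/(alg_map c *: (y : W')).
  by rewrite !scalerA -!alg_mapC -!scalerA mpureM.
Qed.

Lemma tact1B a a' : zmod_morphism (tact1 a a').
Proof. exact: btliftB (tact1_bal a a'). Qed.

Lemma tact1E a a' w w' : tact1 a a' (mpure w w') = mpure (a *: w) (a' *: w').
Proof. exact: (btliftE (tact1_bal a a')). Qed.

Fact add_zmod (Z Z' : zmodType) (f g : Z -> Z') :
  zmod_morphism f -> zmod_morphism g -> zmod_morphism (fun z => f z + g z).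
Proof. by move=> fB gB x y; rewrite fB gB opprD addrACA. Qed.

Fact sub_zmod (Z Z' : zmodType) (f g : Z -> Z') :
  zmod_morphism f -> zmod_morphism g -> zmod_morphism (fun z => f z - g z).
Proof. by move=> fB gB x y; rewrite fB gB !opprD !opprK addrACA. Qed.

Fact tact_bal u : balanced (fun (a : restr A^o) (c : F) => c *: a)
  (fun (c : F) (a' : restr A'^o) => c *: a')
  (fun (a : restr A^o) (a' : restr A'^o) => tact1 a a' u).
Proof.
split=> [x x' y|x y y'|x c y].
- move: u; apply: mtens_ext; [exact: tact1B|by apply: add_zmod; apply: tact1B|].
  by move=> w w'; rewrite !tact1E scalerDl mpureDl.
- move: u; apply: mtens_ext; [exact: tact1B|by apply: add_zmod; apply: tact1B|].
  by move=> w w'; rewrite !tact1E scalerDl mpureDr.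
- move: u; apply: mtens_ext; [exact: tact1B|exact: tact1B|] => w w'.
  rewrite !tact1E [c *: x]/(alg_map c * (x : A)) [c *: y]/(alg_map c * (y : A')).
  by rewrite -!scalerA mpureM.
Qed.

Lemma tactBl u : zmod_morphism (tact^~ u).
Proof. exact: btliftB (tact_bal u). Qed.

Lemma tact_apure a a' u : tact (apure a a') u = tact1 a a' u.
Proof. exact: (btliftE (tact_bal u)). Qed.

Lemma tactE a a' w w' :
  tact (apure a a') (mpure w w') = mpure (a *: w) (a' *: w').
Proof. by rewrite tact_apure tact1E. Qed.

Lemma tactBr t : zmod_morphism (tact t).
Proof.
move=> u v; move: t; apply: zmorph_ext => [||a a'].
- exact: tactBl.
- by apply: sub_zmod; apply: tactBl.
- by rewrite -[btpure _ _ a a']/(apure a a') !tact_apure tact1B.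
Qed.

Lemma tact1_id u : tact (apure 1 1) u = u.
Proof.
move: u; apply: mtens_ext => // [|w w']; first exact: tactBr.
by rewrite tactE !scale1r.
Qed.

End TensorAction.

Section TensorModules.
Variables (F : comPzRingType) (A A' : pzAlgType F).

Fact tactA (W : lmodType A) (W' : lmodType A') (t s : atens A A') (u : mtens W W') :
  tact t (tact s u) = tact (tact t s) u.
Proof.
move: t; apply: zmorph_ext => [||a a']; first exact: tactBl.
  by move=> x y; rewrite !tactBl.
move: s; apply: zmorph_ext => [||b b'].
- by move=> x y; rewrite tactBl tactBr.
- by move=> x y; rewrite tactBr tactBl.
move: u; apply: zmorph_ext => [||w w'].
- by move=> x y; rewrite !tactBr.
- exact: tactBr.
- rewrite -[btpure _ _ a a']/(apure a a') -[btpure _ _ b b']/(apure b b').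
  by rewrite -[btpure _ _ w w']/(mpure w w') !tactE !scalerA.
Qed.

Fact tact_id1 (t : atens A A') : tact t (apure 1 1) = t.
Proof.
move: t; apply: zmorph_ext => [||a a'] //; first exact: tactBl.
by rewrite -[btpure _ _ a a']/(apure a a') tactE /apure -[a%R *: _]/(a * 1) -[a' *: _]/(a' * 1) !mulr1.
Qed.

Fact atens_mulDl : left_distributive (@tact F A A' A^o A'^o) +%R.
Proof.
move=> x y z; have h := @tactBl F A A' A^o A'^o z.
by have := h (x + y) y; rewrite addrK => /eqP; rewrite eq_sym subr_eq => /eqP.
Qed.

Fact atens_mulDr : right_distributive (@tact F A A' A^o A'^o) +%R.
Proof.
move=> z x y; have h := @tactBr F A A' A^o A'^o z.
by have := h (x + y) y; rewrite addrK => /eqP; rewrite eq_sym subr_eq => /eqP.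
Qed.

(* (a (x) a') (b (x) b') = a b (x) a' b'.                      *)
HB.instance Definition _ := GRing.Zmodule_isPzRing.Build (atens A A')
  (@tactA A^o A'^o) (@tact1_id F A A' A^o A'^o) tact_id1 atens_mulDl atens_mulDr.

Lemma apureM (a b : A) (a' b' : A') :
  apure a a' * apure b b' = apure (a * b) (a' * b').
Proof. exact: tactE. Qed.

End TensorModules.

Section TensorScalars.
Variables (F : comPzRingType) (A A' : pzAlgType F).

Definition atens_map (c : F) : atens A A' := apure (alg_map c) 1.

Fact alg_map_atens_zmod : zmod_morphism atens_map.
Proof.
move=> c d; rewrite /atens_map rmorphB /apure.
have := @mpureDl F A A' A^o A'^o (alg_map c - alg_map d) (alg_map d) 1.
by rewrite subrK => ->; rewrite addrK.
Qed.

Fact alg_map_atens_monoid :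
  monoid_morphism atens_map.
Proof. by split=> [|c d]; rewrite /atens_map ?rmorph1 // apureM rmorphM mulr1. Qed.

HB.instance Definition _ := GRing.isZmodMorphism.Build F (atens A A')
  atens_map alg_map_atens_zmod.
HB.instance Definition _ := GRing.isMonoidMorphism.Build F (atens A A')
  atens_map alg_map_atens_monoid.

Fact alg_map_atensC (c : F) (t : atens A A') :
  atens_map c * t = t * atens_map c.
Proof.
move: t; apply: zmorph_ext => [||a a'].
- by move=> x y; rewrite mulrBr.
- by move=> x y; rewrite mulrBl.
- by rewrite -[btpure _ _ a a']/(apure a a') /atens_map !apureM mulr1 mul1r alg_mapC.
Qed.

HB.instance Definition _ := isPzAlgebra.Build F (atens A A') alg_map_atensC.

Section Modules.
Variables (W : lmodType A) (W' : lmodType A').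

Fact mtens_scaleDr : right_distributive (@tact F A A' W W') +%R.
Proof.
move=> t x y; have := @tactBr F A A' W W' t (x + y) y.
by rewrite addrK => /eqP; rewrite eq_sym subr_eq => /eqP.
Qed.

Fact mtens_scaleDl u : {morph (@tact F A A' W W')^~ u : s t / s + t}.
Proof.
move=> s t; have := @tactBl F A A' W W' u (s + t) t.
by rewrite addrK => /eqP; rewrite eq_sym subr_eq => /eqP.
Qed.

HB.instance Definition _ := GRing.Zmodule_isLmodule.Build (atens A A')
  (mtens W W') (@tactA F A A' W W') (@tact1_id F A A' W W')
  mtens_scaleDr mtens_scaleDl.

Lemma mpureZ (a : A) (a' : A') (w : W) (w' : W') :
  apure a a' *: mpure w w' = mpure (a *: w) (a' *: w').
Proof. exact: tactE. Qed.

End Modules.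
End TensorScalars.

(* T (x)_B X for a ring morphism phi : B -> T, through which B acts on the   *)
(* right of T; it is a left T-module by t (u (x) x) = t u (x) x.             *)
Definition bchange (B T : pzRingType) (phi : {rmorphism B -> T})
    (X : lmodType B) : Type :=
  btens (fun (t : T) (b : B) => t * phi b) (fun (b : B) (x : X) => b *: x).

Section BaseChange.
Variables (B T : pzRingType) (phi : {rmorphism B -> T}) (X : lmodType B).

HB.instance Definition _ := GRing.Zmodule.on (bchange phi X).

Definition bpure (t : T) (x : X) : bchange phi X := btpure _ _ t x.

Definition bchange_scale (t : T) : bchange phi X -> bchange phi X :=
  btlift (fun u x => bpure (t * u) x).

Fact bchange_bal t : balanced (fun (t : T) (b : B) => t * phi b)
  (fun (b : B) (x : X) => b *: x) (fun u x => bpure (t * u) x).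
Proof.
split=> [x x' y|x y y'|x c y].
- by rewrite mulrDr; apply: btpureDl.
- exact: btpureDr.
- rewrite mulrA; exact: (btpureM (fun (t : T) (b : B) => t * phi b)).
Qed.

Fact bchange_scaleE t u x : bchange_scale t (bpure u x) = bpure (t * u) x.
Proof. exact: (btliftE (bchange_bal t)). Qed.

Fact bchange_scaleB t : zmod_morphism (bchange_scale t).
Proof. exact: btliftB (bchange_bal t). Qed.

Fact bchange_scaleA s t z :
  bchange_scale s (bchange_scale t z) = bchange_scale (s * t) z.
Proof.
move: z; apply: zmorph_ext => [||u x].
- by move=> x y; rewrite !bchange_scaleB.
- exact: bchange_scaleB.
- by rewrite -[btpure _ _ u x]/(bpure u x) !bchange_scaleE mulrA.
Qed.

Fact bchange_scale1 : left_id 1 bchange_scale.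
Proof.
apply: zmorph_ext => [|//|u x]; first exact: bchange_scaleB.
by rewrite -[btpure _ _ u x]/(bpure u x) bchange_scaleE mul1r.
Qed.

Fact bchange_scaleDr : right_distributive bchange_scale +%R.
Proof.
move=> t x y; have := bchange_scaleB t (x + y) y.
by rewrite addrK => /eqP; rewrite eq_sym subr_eq => /eqP.
Qed.

Fact bchange_scaleDl z : {morph bchange_scale^~ z : s t / s + t}.
Proof.
move=> s t; move: z; apply: zmorph_ext => [||u x].
- exact: bchange_scaleB.
- by apply: add_zmod; apply: bchange_scaleB.
- rewrite -[btpure _ _ u x]/(bpure u x) !bchange_scaleE mulrDl.
  exact: btpureDl.
Qed.

HB.instance Definition _ := GRing.Zmodule_isLmodule.Build T (bchange phi X)
  bchange_scaleA bchange_scale1 bchange_scaleDr bchange_scaleDl.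

Lemma bpureZ (t u : T) (x : X) : t *: bpure u x = bpure (t * u) x.
Proof. exact: bchange_scaleE. Qed.

End BaseChange.

(* V is the internal direct sum of the submodules V_ g, g : G.               *)
Record direct_decomp (G : groupType) (F : pzRingType) (V : lmodType F)
    (V_ : G -> {pred V}) : Prop := DirectDecomp {
  decomp_submod : forall g, submod_closed (V_ g);
  decomp_span : forall v, exists s : seq G, exists f : G -> V,
    [/\ uniq s, forall g, f g \in V_ g & v = \sum_(g <- s) f g];
  decomp_free : forall (s : seq G) (f : G -> V),
    uniq s -> (forall g, f g \in V_ g) -> \sum_(g <- s) f g = 0 ->
    {in s, forall g, f g = 0}
}.

Record alg_grading (G : groupType) (F : pzRingType) (A : pzAlgType F) :=
  AlgGrading {
    agr :> G -> {pred A};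
    agr_decomp : direct_decomp (agr : G -> {pred restr A^o});
    agrM : forall g h a b, a \in agr g -> b \in agr h -> a * b \in agr (g * h)%g
  }.

Record mod_grading (G : groupType) (F : pzRingType) (A : pzAlgType F)
    (gA : alg_grading G A) (W : lmodType A) := ModGrading {
  mgr :> G -> {pred W};
  mgr_decomp : direct_decomp (mgr : G -> {pred restr W});
  mgrZ : forall g h a w, a \in gA g -> w \in mgr h -> a *: w \in mgr (g * h)%g
}.

(* A_g A_h denotes the span of the products; as A_g is an F-subspace, the    *)
(* additive span is the linear span.                                         *)
Definition strongly_graded (G : groupType) (F : pzRingType) (A : pzAlgType F)
    (gA : alg_grading G A) : Prop :=
  forall (g h : G) (a : A), a \in gA (g * h)%g <->
    zspan (fun x => exists b c, [/\ b \in gA g, c \in gA h & x = b * c]) a.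

Section GradingTheory.
Variables (G : groupType) (F : pzRingType) (A : pzAlgType F).
Variable (gA : alg_grading G A).

Fact agr_zmod g : zmod_closed (gA g).
Proof. exact: GRing.submod_closedB (decomp_submod (agr_decomp gA) g). Qed.

Lemma agr1 : 1 \in gA 1%g.
Proof.
have [_ span free] := agr_decomp gA.
have g0 g : 0 \in gA g by case: (agr_zmod g).
have gB g a b : a \in gA g -> b \in gA g -> a - b \in gA g by case: (agr_zmod g) => _; apply.
have [s0 [f0 [us0 f0P E0]]] := span (1 : A).
pose s := undup (1%g :: s0).
pose e g := if g \in s0 then f0 g else 0 : A.
have eP g : e g \in gA g by rewrite /e; case: ifP => _ //; apply: f0P.
have us : uniq s by apply: undup_uniq.
have E : \sum_(g <- s) e g = 1.
  rewrite /s /=; case: ifP => [|/negbT] h; rewrite undup_id //.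
    by rewrite E0; apply: eq_big_seq => g gs; rewrite /e gs.
  rewrite big_cons {1}/e (negPf h) add0r E0.
  by apply: eq_big_seq => g gs; rewrite /e gs.
have e1 h x : x \in gA h -> e 1%g * x = x.
  move=> xh; pose f k := e (k * h^-1)%g * x - (if k == h then x else 0).
  have fP k : f k \in gA k.
    apply: gB; last by case: eqP => [->|].
    by rewrite -[k in gA k](mulgVK h); apply: agrM.
  have := free [seq (g * h)%g | g <- s] f.
  rewrite map_inj_uniq ?us; last exact: mulIg.
  move=> /(_ isT fP) H.
  suff /H /(_ h) : \sum_(g <- [seq (g * h)%g | g <- s]) f g = 0.
    rewrite /f mulgV eqxx => /(_ _)/eqP; rewrite subr_eq0 => K; apply/eqP/K.
    by apply/mapP; exists 1%g; rewrite ?mul1g // mem_undup inE eqxx.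
  rewrite big_map /f sumrB.
  under eq_bigr do rewrite mulgK.
  rewrite -mulr_suml E mul1r.
  rewrite (bigD1_seq 1%g) //= ?mem_undup ?inE ?eqxx // mul1g eqxx.
  rewrite big1 ?addr0 ?subrr // => g /negPf g1.
  by rewrite -[X in _ == X]mul1g (inj_eq (mulIg h)) g1.
have e1v v : e 1%g * v = v.
  have [t [f [_ fP ->]]] := span (v : A).
  by rewrite mulr_sumr; apply: eq_bigr => g _; apply: (e1 g).
by rewrite -(e1v 1) mulr1.
Qed.

End GradingTheory.

Section GradedProduct.
Variables (G : groupType) (F : comPzRingType) (A A' : pzAlgType F).
Variables (gA : alg_grading G A) (gA' : alg_grading G A').

Definition gatens_pred : {pred atens A A'} :=
  zspanp (fun t => exists g a a', [/\ a \in gA g, a' \in gA' g & t = apure a a']).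

Fact gatens_closed : subring_closed gatens_pred.
Proof.
split.
- by apply/zspanpP/zspan_gen; exists 1%g, 1, 1; split; rewrite ?agr1.
- by case: (zspanp_closed (fun t => exists g a a',
    [/\ a \in gA g, a' \in gA' g & t = apure a a'])).
- move=> x y /zspanpP xP /zspanpP yP; apply/zspanpP.
  elim: xP => [|_ [g [a [a' [ag a'g ->]]]]|x1 x2 _ IH1 _ IH2].
  + by rewrite mul0r; apply: zspan0.
  + elim: yP => [|_ [h [b [b' [bh b'h ->]]]]|y1 y2 _ IH1 _ IH2].
    * by rewrite mulr0; apply: zspan0.
    * apply: zspan_gen; exists (g * h)%g, (a * b), (a' * b').
      by rewrite apureM; split=> //; apply: agrM.
    * by rewrite mulrBr; apply: zspanB.
  + by rewrite mulrBl; apply: zspanB.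
Qed.

HB.instance Definition _ :=
  GRing.isSubringClosed.Build (atens A A') gatens_pred gatens_closed.

(* The graded product of algebras, the sum of the A_g (x) A'_g.              *)
Record gatens := GATens { gatval : atens A A'; _ : gatval \in gatens_pred }.

HB.instance Definition _ := [isSub for gatval].
HB.instance Definition _ := [Choice of gatens by <:].
HB.instance Definition _ := GRing.SubChoice_isSubPzRing.Build (atens A A') gatens_pred gatens
  gatens_closed.
HB.instance Definition _ := GRing.RMorphism.copy gatval (val : gatens -> atens A A').

Variables (W : lmodType A) (W' : lmodType A').
Variables (gW : mod_grading gA W) (gW' : mod_grading gA' W').

Definition gmtens_pred : {pred mtens W W'} :=
  zspanp (fun u => exists g w w', [/\ w \in gW g, w' \in gW' g & u = mpure w w']).

HB.instance Definition _ := GRing.ZmodClosed.on gmtens_pred.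

(* The graded product of modules, the sum of the W_g (x) W'_g.               *)
Record gmtens := GMTens { gmtval : mtens W W'; _ : gmtval \in gmtens_pred }.

HB.instance Definition _ := [isSub for gmtval].
HB.instance Definition _ := [Choice of gmtens by <:].
HB.instance Definition _ := [SubChoice_isSubZmodule of gmtens by <:].

Fact gmtens_scale_closed (t : gatens) (u : gmtens) :
  gatval t *: gmtval u \in gmtens_pred.
Proof.
case: t u => [t /= /zspanpP tP] [u /= /zspanpP uP]; apply/zspanpP.
elim: tP => [|_ [g [a [a' [ag a'g ->]]]]|x1 x2 _ IH1 _ IH2].
- by rewrite scale0r; apply: zspan0.
- elim: uP => [|_ [h [w [w' [wh w'h ->]]]]|y1 y2 _ IH1 _ IH2].
  + by rewrite scaler0; apply: zspan0.
  + apply: zspan_gen; exists (g * h)%g, (a *: w), (a' *: w').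
    by rewrite mpureZ; split=> //; apply: mgrZ.
  + by rewrite scalerBr; apply: zspanB.
- by rewrite scalerBl; apply: zspanB.
Qed.

Definition gmtens_scale (t : gatens) (u : gmtens) : gmtens :=
  GMTens (gmtens_scale_closed t u).

Fact gmtens_scaleA s t u :
  gmtens_scale s (gmtens_scale t u) = gmtens_scale (s * t) u.
Proof. by apply: val_inj; rewrite /= scalerA. Qed.
Fact gmtens_scale1 : left_id 1 gmtens_scale.
Proof. by move=> u; apply: val_inj; rewrite /= scale1r. Qed.
Fact gmtens_scaleDr : right_distributive gmtens_scale +%R.
Proof. by move=> t u v; apply: val_inj; rewrite /= scalerDr. Qed.
Fact gmtens_scaleDl u : {morph gmtens_scale^~ u : s t / s + t}.
Proof. by move=> s t; apply: val_inj; rewrite /= scalerDl. Qed.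

HB.instance Definition _ := GRing.Zmodule_isLmodule.Build gatens gmtens
  gmtens_scaleA gmtens_scale1 gmtens_scaleDr gmtens_scaleDl.

End GradedProduct.

(* Main.v *)
Require Import Defs.
From HB Require Import structures.
From mathcomp Require Import all_boot all_algebra.
From mathcomp Require Import boolp.

(** Write T for the tensor product of the two algebras, B for their graded
    product and X for the graded product of the modules. The map
    t (x) x |-> t x from T (x)_B X to W (x) W' is T-linear ([graded_mul]), and
    the point is that strong grading makes it invertible.

    The pure tensors that span X have both factors of the same degree. Given
    w and w' of arbitrary degrees g and h, set k = g h^-1; since 1 is in
    A_1 = A_k A_k^-1, there are b_i in A_k and c_i in A_k^-1 with
    sum_i b_i c_i = 1 ([strongly_graded_unity]). As c_i w has degree h,

      sum_i (b_i (x) 1) (x) (c_i w (x) w')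

    is an element of T (x)_B X, mapped to w (x) w' ([untwistK]). This formula
    ([untwist]) is additive in w and in w', hence extends along the direct
    sums W = (+) W_g and W' = (+) W'_h ([decomp_ext]) to an F-bilinear map,
    which is the inverse [graded_unmul].

    That it is a left inverse is checked on generators
    (a (x) a') (x) (w (x) w'), with a, a' of degrees p, q and w, w' both of
    degree h ([untwist_act]). Then k = p q^-1, so c_i a and a' have the same
    degree q: the factor c_i a (x) a' belongs to B and crosses the tensor sign,
    and what remains is sum_i (b_i c_i a (x) a') (x) (w (x) w'). *)

Set Implicit Arguments.
Unset Strict Implicit.
Unset Printing Implicit Defensive.

Import GRing.Theory.
Local Open Scope ring_scope.

(** * Additive maps *)

Section ZmodMorphism.
Variables (U Z : zmodType) (f : U -> Z).
Hypothesis fB : zmod_morphism f.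

Lemma zmod_morph0 : f 0 = 0.
Proof. by rewrite -[X in f X](subrr 0) fB subrr. Qed.

Lemma zmod_morphN x : f (- x) = - f x.
Proof. by rewrite -[X in f X]add0r fB zmod_morph0 add0r. Qed.

Lemma zmod_morphD x y : f (x + y) = f x + f y.
Proof. by rewrite -{1}[y]opprK fB zmod_morphN opprK. Qed.

Lemma zmod_morph_sum I (s : seq I) (e : I -> U) :
  f (\sum_(i <- s) e i) = \sum_(i <- s) f (e i).
Proof. exact: (big_morph f zmod_morphD zmod_morph0). Qed.

End ZmodMorphism.

Lemma add_zmod_morphism (U Z : zmodType) (f : U -> Z) :
  {morph f : x y / x + y} -> zmod_morphism f.
Proof.
move=> fD x y; apply: (@addIr _ (f y)).
by rewrite -fD !subrK.
Qed.

(** * Additive maps out of an internal direct sum *)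

Section DirectSum.
Variables (G : groupType) (F : pzRingType) (V : lmodType F).
Variables (V_ : G -> {pred V}) (dV : direct_decomp V_).

Lemma decomp_mem0 g : 0 \in V_ g.
Proof. by case: (GRing.submod_closedB (decomp_submod dV g)). Qed.

Lemma decomp_memB g : {in V_ g &, forall x y, x - y \in V_ g}.
Proof. by case: (GRing.submod_closedB (decomp_submod dV g)). Qed.

Lemma decomp_memZ g c v : v \in V_ g -> c *: v \in V_ g.
Proof.
case: (decomp_submod dV g) => V0 Vlin vg.
by rewrite -[c *: v]addr0; apply: Vlin.
Qed.

Lemma decomp_additive_ext (Z : zmodType) (f f' : V -> Z) :
  zmod_morphism f -> zmod_morphism f' ->
  (forall g, {in V_ g, f =1 f'}) -> f =1 f'.
Proof.
move=> fB f'B ff' v; have [s [e [_ eV ->]]] := decomp_span dV v.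
by rewrite !zmod_morph_sum //; apply: eq_bigr => g _; apply: ff' (eV g).
Qed.

Fact decomp_exists v : exists p : seq G * (G -> V),
  [/\ uniq p.1, forall g, p.2 g \in V_ g & v = \sum_(g <- p.1) p.2 g].
Proof. by have [s [f sf]] := decomp_span dV v; exists (s, f). Qed.

Definition decomp v := projT1 (cid (decomp_exists v)).

Fact decompP v : [/\ uniq (decomp v).1, forall g, (decomp v).2 g \in V_ g &
  v = \sum_(g <- (decomp v).1) (decomp v).2 g].
Proof. exact: projT2 (cid (decomp_exists v)). Qed.

(** Two decompositions of a vector may run over different index lists; padding
    with zeros brings them to a common list, where [decomp_free] applies. *)
Definition pad (s : seq G) (f : G -> V) g := if g \in s then f g else 0.

Lemma pad_mem s f : (forall g, f g \in V_ g) -> forall g, pad s f g \in V_ g.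
Proof. by move=> fV g; rewrite /pad; case: ifP => // _; apply: decomp_mem0. Qed.

Lemma sum_pad (Z : zmodType) (phi : G -> V -> Z) s u f :
    uniq s -> uniq u -> {subset s <= u} -> (forall g, phi g 0 = 0) ->
  \sum_(g <- u) phi g (pad s f g) = \sum_(g <- s) phi g (f g).
Proof.
move=> us uu su phi0; rewrite (bigID (mem s)) /= [X in _ + X]big1 ?addr0; last first.
  by move=> g /negPf gs; rewrite /pad gs phi0.
rewrite -big_filter; rewrite (perm_big s); last first.
  apply: uniq_perm => //; first exact: filter_uniq.
  by move=> g; rewrite mem_filter /=; case: (boolP (g \in s)) => // /su.
by apply: eq_big_seq => g gs; rewrite /pad gs.
Qed.

Section Extension.
Variables (Z : zmodType) (phi : G -> V -> Z).

(** The map that restricts to [phi g] on each summand [V_ g]. The pieces are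
    total functions on [V], of which only the values on [V_ g] count, and the
    decomposition of [v] is a chosen one: that the choice is immaterial is
    [decomp_ext_sum], from which additivity follows. *)
Definition decomp_ext v := \sum_(g <- (decomp v).1) phi g ((decomp v).2 g).

Hypothesis phiB : forall g, {in V_ g &, {morph phi g : x y / x - y}}.

Fact piece0 g : phi g 0 = 0.
Proof. by have := phiB (decomp_mem0 g) (decomp_mem0 g); rewrite !subrr. Qed.

Lemma decomp_ext_sum s f : uniq s -> (forall g, f g \in V_ g) ->
  decomp_ext (\sum_(g <- s) f g) = \sum_(g <- s) phi g (f g).
Proof.
move=> us fV; set v := \sum_(g <- s) f g; rewrite /decomp_ext.
have [] := decompP v; set s' := (decomp v).1; set f' := (decomp v).2.
move=> us' f'V vE; pose u := undup (s ++ s').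
have uu : uniq u by apply: undup_uniq.
have su : {subset s <= u} by move=> g gs; rewrite mem_undup mem_cat gs.
have s'u : {subset s' <= u} by move=> g gs; rewrite mem_undup mem_cat gs orbT.
rewrite -(sum_pad f us uu su piece0) -(sum_pad f' us' uu s'u piece0).
apply: eq_big_seq => g gu; congr (phi g _); apply/eqP; rewrite -subr_eq0; apply/eqP.
apply: (decomp_free dV uu _ _ gu (f := fun g => pad s' f' g - pad s f g)).
  by move=> h; apply: decomp_memB; apply: pad_mem.
by rewrite sumrB !(sum_pad (phi := fun=> id)) // -vE subrr.
Qed.

Lemma decomp_extB : zmod_morphism decomp_ext.
Proof.
move=> x y; have [] := decompP x; have [] := decompP y.
set s := (decomp x).1; set s' := (decomp y).1.
set f := (decomp x).2; set f' := (decomp y).2.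
move=> us' f'V yE us fV xE; pose u := undup (s ++ s').
have uu : uniq u by apply: undup_uniq.
have su : {subset s <= u} by move=> g gs; rewrite mem_undup mem_cat gs.
have s'u : {subset s' <= u} by move=> g gs; rewrite mem_undup mem_cat gs orbT.
have -> : x - y = \sum_(g <- u) (pad s f g - pad s' f' g).
  by rewrite sumrB !(sum_pad (phi := fun=> id)) // -xE -yE.
rewrite decomp_ext_sum //; last by move=> g; apply: decomp_memB; apply: pad_mem.
rewrite -[decomp_ext x](sum_pad f us uu su piece0).
rewrite -[decomp_ext y](sum_pad f' us' uu s'u piece0) -sumrB.
by apply: eq_bigr => g _; apply: phiB; apply: pad_mem.
Qed.

Lemma decomp_extE g v : v \in V_ g -> decomp_ext v = phi g v.
Proof.
move=> vg; have := decomp_ext_sum (s := [:: g]) (f := pad [:: g] (fun=> v)) isT.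
rewrite !big_seq1 /pad mem_head; apply=> h.
by rewrite inE; case: eqP => [->|_] //; apply: decomp_mem0.
Qed.

End Extension.

End DirectSum.

(** * Pure tensors and linear maps out of a base change *)

Section PureTensors.
Variables (F : comPzRingType) (A A' : pzAlgType F).
Variables (W : lmodType A) (W' : lmodType A').

Lemma mpureBl (w' : W') : zmod_morphism (fun w : W => mpure w w').
Proof. by apply: add_zmod_morphism => x y; apply: mpureDl. Qed.

Lemma mpureBr (w : W) : zmod_morphism (fun w' : W' => mpure w w').
Proof. by apply: add_zmod_morphism => x y; apply: mpureDr. Qed.

Lemma apureBl (a' : A') : zmod_morphism (fun a : A => apure a a').
Proof. by apply: add_zmod_morphism => x y; apply: btpureDl. Qed.

Lemma apureBr (a : A) : zmod_morphism (fun a' : A' => apure a a').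
Proof. by apply: add_zmod_morphism => x y; apply: btpureDr. Qed.

End PureTensors.

Section BasePureTensors.
Variables (B T : pzRingType) (phi : {rmorphism B -> T}) (X : lmodType B).

Lemma bpureBl (x : X) : zmod_morphism (fun t => bpure phi t x).
Proof. by apply: add_zmod_morphism => s t; apply: btpureDl. Qed.

Lemma bpureBr (t : T) : zmod_morphism (fun x : X => bpure phi t x).
Proof. by apply: add_zmod_morphism => x y; apply: btpureDr. Qed.

End BasePureTensors.

Section BaseChangeLift.
Variables (B T : pzRingType) (phi : {rmorphism B -> T}) (X : lmodType B).
Variables (M : lmodType T) (j : X -> M).
Hypotheses (jB : zmod_morphism j) (jZ : forall b x, j (b *: x) = phi b *: j x).

(** The extension-restriction adjunction: a map [j] semilinear along [phi]
    induces a [T]-linear map on the base change. *)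
Definition bchange_lift : bchange phi X -> M := btlift (fun t x => t *: j x).

Fact bchange_lift_bal : balanced (fun (t : T) (b : B) => t * phi b)
  (fun (b : B) (x : X) => b *: x) (fun t x => t *: j x).
Proof.
split=> [s t x|t x y|t b x]; first exact: scalerDl.
  by rewrite zmod_morphD // scalerDr.
by rewrite jZ scalerA.
Qed.

Lemma bchange_liftB : zmod_morphism bchange_lift.
Proof. exact: btliftB bchange_lift_bal. Qed.

Lemma bchange_liftE t x : bchange_lift (bpure phi t x) = t *: j x.
Proof. exact: btliftE bchange_lift_bal t x. Qed.

Lemma bchange_liftZ t z : bchange_lift (t *: z) = t *: bchange_lift z.
Proof.
move: z; apply: zmorph_ext => [x y|x y|s x].
- by rewrite scalerBr bchange_liftB.
- by rewrite bchange_liftB scalerBr.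
rewrite -[btpure _ _ s x]/(bpure phi s x) bpureZ !bchange_liftE.
by rewrite scalerA.
Qed.

Lemma bchange_lift_linear : linear bchange_lift.
Proof. by move=> t x y; rewrite zmod_morphD ?bchange_liftZ //; apply: bchange_liftB. Qed.

End BaseChangeLift.

(** * Strongly graded algebras *)

(** The unit has degree 1 = k k^-1, so strong grading makes it a sum of products
    of homogeneous elements of the opposite degrees k and k^-1. Multiplying by
    the right factors shifts degrees by k^-1, and multiplying back by the left
    factors undoes it. *)
Lemma strongly_graded_unity (G : groupType) (F : pzRingType) (A : pzAlgType F)
    (gA : alg_grading G A) (k : G) : strongly_graded gA ->
  exists D : seq (A * A),
    (forall p, p \in D -> p.1 \in gA k /\ p.2 \in gA k^-1%g) /\
    \sum_(p <- D) p.1 * p.2 = 1.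
Proof.
move=> /(_ k k^-1%g 1) [/(_ _) span1 _]; have := agr1 gA.
rewrite -(mulgV k) => /span1; elim=> [|x [b [c [bk ck ->]]]|x y _ [D [DP <-]] _ [E [EP <-]]].
- by exists [::]; rewrite big_nil.
- exists [:: (b, c)]; rewrite big_seq1; split=> // p.
  by rewrite inE => /eqP ->.
- exists (D ++ [seq (- p.1, p.2) | p <- E]); split.
    move=> p; rewrite mem_cat => /orP[/DP //|/mapP[q /EP[q1 q2] ->]].
    split=> //=; rewrite -sub0r; case: (agr_zmod gA k) => A0 AB; exact: AB.
  rewrite big_cat big_map /= -sumrN; congr (_ + _).
  by apply: eq_bigr => p _; rewrite mulNr.
Qed.

(** * The multiplication map and its inverse *)

Section GradedTensor.
Variables (F : comPzRingType) (G : groupType) (A A' : pzAlgType F).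
Variables (gA : alg_grading G A) (gA' : alg_grading G A').
Variables (W : lmodType A) (W' : lmodType A').
Variables (gW : mod_grading gA W) (gW' : mod_grading gA' W').

Local Notation T := (atens A A').
Local Notation B := (gatens gA gA').
Local Notation X := (gmtens gW gW').
Local Notation gatval := (@gatval G F A A' gA gA').
Local Notation gmtval := (@gmtval G F A A' gA gA' W W' gW gW').
Local Notation TX := (bchange gatval X).

(** Meaningful when [w] and [w'] are homogeneous of one degree ([gmpureE]); the
    default value 0 makes it total, so that it can be used in formulas whose
    degree conditions are only known afterwards. *)
Definition gmpure (w : W) (w' : W') : X := insubd 0 (mpure w w').

Lemma gmpureE g w w' : w \in gW g -> w' \in gW' g ->
  gmtval (gmpure w w') = mpure w w'.
Proof.
move=> wg w'g; apply: (insubdK (0 : X)).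
by apply/zspanpP/zspan_gen; exists g, w, w'.
Qed.

Fact gmtvalB : zmod_morphism (gmtval : X -> mtens W W').
Proof. by []. Qed.

Lemma gmtens_ext (Z : zmodType) (f f' : X -> Z) :
    zmod_morphism f -> zmod_morphism f' ->
    (forall g w w', w \in gW g -> w' \in gW' g ->
       f (gmpure w w') = f' (gmpure w w')) ->
  f =1 f'.
Proof.
move=> fB f'B ff' [u uP]; have /zspanpP uS := uP.
(* Induction on the span needs a statement about elements of the ambient *)
(* tensor product, hence the preimage [x] in place of [GMTens uP].       *)
suff K : exists x : X, gmtval x = u /\ f x = f' x.
  by have [x [xu]] := K; have -> : x = GMTens uP by apply: val_inj.
elim: uS => [|_ [g [w [w' [wg w'g ->]]]]|_ _ _ [x [<- fx]] _ [y [<- fy]]].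
- by exists 0; rewrite !zmod_morph0.
- by exists (gmpure w w'); rewrite (gmpureE wg w'g) (ff' g).
- by exists (x - y); rewrite fB f'B fx fy.
Qed.

Fact gmtvalZ (b : B) (x : X) : gmtval (b *: x) = gatval b *: gmtval x.
Proof. by []. Qed.

Definition graded_mul : TX -> mtens W W' :=
  bchange_lift (phi := gatval) (gmtval : X -> mtens W W').

Lemma graded_mulB : zmod_morphism graded_mul.
Proof. exact: bchange_liftB gmtvalB gmtvalZ. Qed.

Lemma graded_mulE t x : graded_mul (bpure gatval t x) = t *: gmtval x.
Proof. exact: bchange_liftE gmtvalB gmtvalZ t x. Qed.

(** The balancing relation of the base change, for the generators of the graded
    product of the algebras. *)
Lemma bpure_homog t q a a' h w w' :
    a \in gA q -> a' \in gA' q -> w \in gW h -> w' \in gW' h ->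
  bpure gatval (t * apure a a') (gmpure w w') =
  bpure gatval t (gmpure (a *: w) (a' *: w')).
Proof.
move=> aq a'q wh w'h.
have bP : apure a a' \in gatens_pred gA gA'.
  by apply/zspanpP/zspan_gen; exists q, a, a'.
have -> : gmpure (a *: w) (a' *: w') = GATens bP *: gmpure w w'.
  apply: val_inj; rewrite /= -/(gmtval _).
  rewrite (gmpureE (mgrZ aq wh) (mgrZ a'q w'h)) -mpureZ.
  by rewrite -(gmpureE wh w'h).
exact: (btpureM (fun (t : T) (b : B) => t * gatval b) _ t (GATens bP)).
Qed.

(** A decomposition of the unit for every degree k, as provided by
    [strongly_graded_unity]. It is fixed once for all because additivity of the
    inverse requires the same decomposition for all vectors of one degree. *)
Variable D : G -> seq (A * A).
Hypothesis DP : forall k p, p \in D k -> p.1 \in gA k /\ p.2 \in gA k^-1%g.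
Hypothesis D1 : forall k, \sum_(p <- D k) p.1 * p.2 = 1.

(** The inverse on W_g (x) W'_h: the degree of [w] is moved from g to h, the
    compensating factors being stored in the scalars. *)
Definition untwist g h (w : W) (w' : W') : TX :=
  \sum_(p <- D (g * h^-1)%g) bpure gatval (apure p.1 1) (gmpure (p.2 *: w) w').

Lemma untwist_mem g h p w : p \in D (g * h^-1)%g -> w \in gW g ->
  p.2 *: w \in gW h.
Proof.
move=> /DP[_ p2] wg; have := mgrZ p2 wg.
by rewrite invgM invgK mulgVK.
Qed.

Lemma untwistBl g h w' : w' \in gW' h ->
  {in gW g &, {morph (untwist g h)^~ w' : x y / x - y}}.
Proof.
move=> w'h x y xg yg; rewrite /untwist -sumrB; apply: eq_big_seq => p pD.
have xh := untwist_mem pD xg; have yh := untwist_mem pD yg.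
have xyh : p.2 *: (x - y) \in gW h.
  by apply: (untwist_mem pD); apply: (decomp_memB (mgr_decomp gW)).
have -> : gmpure (p.2 *: (x - y)) w' = gmpure (p.2 *: x) w' - gmpure (p.2 *: y) w'.
  apply: val_inj; rewrite /= -!/(gmtval _) !(gmpureE (g := h)) // scalerBr.
  exact: mpureBl.
exact: bpureBr.
Qed.

Lemma untwistBr g h w : w \in gW g ->
  {in gW' h &, {morph untwist g h w : x y / x - y}}.
Proof.
move=> wg x y xh yh; rewrite /untwist -sumrB; apply: eq_big_seq => p pD.
have wh := untwist_mem pD wg.
have xyh : x - y \in gW' h by apply: (decomp_memB (mgr_decomp gW')).
have -> : gmpure (p.2 *: w) (x - y) = gmpure (p.2 *: w) x - gmpure (p.2 *: w) y.
  apply: val_inj; rewrite /= -!/(gmtval _) !(gmpureE (g := h)) //.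
  exact: mpureBr.
exact: bpureBr.
Qed.

(** Here the twist is k = p h (q h)^-1 = p q^-1, so the right factors d.2 bring
    [a] to degree q, that of [a']; the tensor of d.2 a and a' is then a scalar
    of the graded product and moves to the left. *)
Lemma untwist_act p q h a a' w w' :
    a \in gA p -> a' \in gA' q -> w \in gW h -> w' \in gW' h ->
  untwist (p * h)%g (q * h)%g (a *: w) (a' *: w') =
  bpure gatval (apure a a') (gmpure w w').
Proof.
move=> ap a'q wh w'h; rewrite /untwist.
have -> : ((p * h) * (q * h)^-1 = p * q^-1)%g by rewrite invgM mulgA mulgK.
transitivity (\sum_(d <- D (p * q^-1)%g)
    bpure gatval (apure (d.1 * d.2 * a) a') (gmpure w w')).
  apply: eq_big_seq => d dD; have [_ d2] := DP dD.
  rewrite scalerA -(bpure_homog _ (q := q) (h := h)) //.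
    by rewrite apureM mul1r mulrA.
  by have := agrM d2 ap; rewrite invgM invgK mulgVK.
have H : zmod_morphism (fun c : A =>
    bpure gatval (apure (c * a) a') (gmpure w w')).
  by move=> x y; rewrite mulrBl apureBl bpureBl.
by rewrite -(zmod_morph_sum H) D1 mul1r.
Qed.

Lemma untwistK g h w w' : w \in gW g -> w' \in gW' h ->
  graded_mul (untwist g h w w') = mpure w w'.
Proof.
move=> wg w'h; rewrite /untwist (zmod_morph_sum graded_mulB).
transitivity (\sum_(p <- D (g * h^-1)%g) mpure ((p.1 * p.2) *: w) w').
  apply: eq_big_seq => p pD.
  by rewrite graded_mulE (gmpureE (untwist_mem pD wg)) // mpureZ scalerA scale1r.
have H : zmod_morphism (fun c : A => mpure (c *: w) w').
  by move=> x y; rewrite scalerBl mpureBl.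
by rewrite -(zmod_morph_sum H) D1 scale1r.
Qed.

(** The inverse on W_g (x) W': the formula depends on both degrees, so it is
    extended first along W' with the degree of [w] fixed, then along W. *)
Definition untwist_ext g (w : restr W) : restr W' -> TX :=
  decomp_ext (mgr_decomp gW') (fun h w' => untwist g h w w').

Lemma untwist_extBr g w : w \in gW g -> zmod_morphism (untwist_ext g w).
Proof. by move=> wg; apply: decomp_extB => h x y xh yh; apply: untwistBr. Qed.

Lemma untwist_extBl g w' :
  {in gW g &, {morph (untwist_ext g)^~ w' : x y / x - y}}.
Proof.
move=> x y xg yg; rewrite /untwist_ext /decomp_ext -sumrB.
have [_ w'V _] := decompP (mgr_decomp gW') w'.
by apply: eq_bigr => h _; apply: (untwistBl (w'V h) xg yg).
Qed.

Definition untwist_bil (w : restr W) (w' : restr W') : TX :=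
  decomp_ext (mgr_decomp gW) (fun g v => untwist_ext g v w') w.

Lemma untwist_bilBr w : zmod_morphism (untwist_bil w).
Proof.
have [_ wV _] := decompP (mgr_decomp gW) w.
move=> x y; rewrite /untwist_bil /decomp_ext -sumrB; apply: eq_bigr => g _.
exact: untwist_extBr (wV g) x y.
Qed.

Lemma untwist_bilBl w' : zmod_morphism (untwist_bil^~ w').
Proof. by apply: decomp_extB => g x y xg yg; apply: untwist_extBl. Qed.

Lemma untwist_bilE g h w w' : w \in gW g -> w' \in gW' h ->
  untwist_bil w w' = untwist g h w w'.
Proof.
move=> wg w'h; have extB k : {in gW k &, {morph (untwist_ext k)^~ w' : x y / x - y}}.
  by move=> x y xk yk; apply: untwist_extBl.
rewrite /untwist_bil (decomp_extE (mgr_decomp gW) extB wg).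
by apply: (decomp_extE (mgr_decomp gW') _ w'h) => k x y xk yk; apply: untwistBr.
Qed.

(** By additivity, F-balancedness is a question about homogeneous vectors, where
    it holds because F is central in A. *)
Lemma untwist_bil_balanced : balanced (fun (w : restr W) (c : F) => c *: w)
  (fun (c : F) (w' : restr W') => c *: w') untwist_bil.
Proof.
split=> [x y w'|w x y|w c w'].
- exact: (zmod_morphD (untwist_bilBl w')).
- exact: (zmod_morphD (untwist_bilBr w)).
apply: (decomp_additive_ext (mgr_decomp gW)
  (f := fun v : restr W => untwist_bil (c *: v : restr W) w')
  (f' := fun v : restr W => untwist_bil v (c *: w' : restr W'))) => [x y|x y|g v vg].
- by rewrite scalerBr; apply: untwist_bilBl.
- exact: untwist_bilBl.
apply: (decomp_additive_ext (mgr_decomp gW')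
  (f := fun v' : restr W' => untwist_bil (c *: v : restr W) v')
  (f' := fun v' : restr W' => untwist_bil v (c *: v' : restr W'))) => [x y|x y|h v' v'h].
- exact: untwist_bilBr.
- by rewrite scalerBr; apply: untwist_bilBr.
have cvg := decomp_memZ (mgr_decomp gW) c vg.
have cv'h := decomp_memZ (mgr_decomp gW') c v'h.
rewrite (untwist_bilE cvg v'h) (untwist_bilE vg cv'h).
apply: eq_bigr => p _; congr (bpure gatval _ _).
rewrite /gmpure; congr (insubd _ _).
rewrite [c *: v]/(alg_map c *: (v : W)) [c *: v']/(alg_map c *: (v' : W')).
by rewrite scalerA -alg_mapC -scalerA mpureM.
Qed.

Definition graded_unmul : mtens W W' -> TX :=
  btlift untwist_bil.

Lemma graded_unmulB : zmod_morphism graded_unmul.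
Proof. exact: btliftB untwist_bil_balanced. Qed.

Lemma graded_unmulE w w' : graded_unmul (mpure w w') = untwist_bil w w'.
Proof. exact: (btliftE untwist_bil_balanced). Qed.

Lemma graded_unmulK : cancel graded_unmul graded_mul.
Proof.
apply: mtens_ext => [x y||w w']; rewrite ?graded_unmulB ?graded_mulB //.
rewrite graded_unmulE.
apply: (decomp_additive_ext (mgr_decomp gW)
  (f := fun v : restr W => graded_mul (untwist_bil v w'))
  (f' := fun v : restr W => mpure (v : W) w')) => [x y||g v vg].
- by rewrite untwist_bilBl graded_mulB.
- exact: mpureBl.
apply: (decomp_additive_ext (mgr_decomp gW')
  (f := fun v' : restr W' => graded_mul (untwist_bil v v'))
  (f' := fun v' : restr W' => mpure (v : W) (v' : W'))) => [x y||h v' v'h].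
- by rewrite untwist_bilBr graded_mulB.
- exact: mpureBr.
by rewrite (untwist_bilE vg v'h) untwistK.
Qed.

Lemma apure_homog_ext (Z : zmodType) (f f' : T -> Z) :
    zmod_morphism f -> zmod_morphism f' ->
    (forall p q a a', a \in gA p -> a' \in gA' q ->
       f (apure a a') = f' (apure a a')) ->
  f =1 f'.
Proof.
move=> fB f'B ff'; apply: zmorph_ext => // a a'.
apply: (decomp_additive_ext (agr_decomp gA)
  (f := fun b : restr A^o => f (apure (b : A) (a' : A')))
  (f' := fun b : restr A^o => f' (apure (b : A) (a' : A')))) => [x y|x y|p b bp].
- by rewrite (apureBl (a' : A')) fB.
- by rewrite (apureBl (a' : A')) f'B.
apply: (decomp_additive_ext (agr_decomp gA')
  (f := fun b' : restr A'^o => f (apure (b : A) (b' : A')))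
  (f' := fun b' : restr A'^o => f' (apure (b : A) (b' : A')))) => [x y|x y|q b' b'q].
- by rewrite (apureBr (b : A)) fB.
- by rewrite (apureBr (b : A)) f'B.
exact: ff' bp b'q.
Qed.

Lemma graded_mulK : cancel graded_mul graded_unmul.
Proof.
apply: zmorph_ext => [x y||t u] //; first by rewrite graded_mulB graded_unmulB.
rewrite -[btpure _ _ t u]/(bpure gatval t u) graded_mulE.
move: t; apply: apure_homog_ext => [x y||p q a a' ap a'q].
- by rewrite scalerBl graded_unmulB.
- exact: bpureBl.
move: u; apply: gmtens_ext => [x y||h w w' wh w'h].
- by rewrite gmtvalB scalerBr graded_unmulB.
- exact: bpureBr.
rewrite (gmpureE wh w'h) mpureZ graded_unmulE.
by rewrite (untwist_bilE (mgrZ ap wh) (mgrZ a'q w'h)) untwist_act.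
Qed.

End GradedTensor.

(** * The isomorphism *)

Theorem corollary4p29 (F : fieldType) (G : groupType) (A A' : pzAlgType F)
    (gA : alg_grading G A) (gA' : alg_grading G A')
    (hA : strongly_graded gA) (hA' : strongly_graded gA')
    (W : lmodType A) (W' : lmodType A')
    (gW : mod_grading gA W) (gW' : mod_grading gA' W') :
  exists f : {linear bchange (@gatval G F A A' gA gA') (gmtens gW gW') -> mtens W W'},
    bijective f.
Proof.
have [D DP] := choice (fun k => strongly_graded_unity k hA).
pose f := @graded_mul F G A A' gA gA' W W' gW gW'.
have f_lin : linear f.
  by apply: bchange_lift_linear; [exact: gmtvalB | exact: gmtvalZ].
pose f_linM := GRing.isLinear.Build _ _ _ _ f f_lin.
pose fL : {linear bchange (@gatval G F A A' gA gA') (gmtens gW gW') -> mtens W W'} :=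
  HB.pack f f_linM.
exists fL.
have D_mem k p : p \in D k -> p.1 \in gA k /\ p.2 \in gA k^-1%g.
  by case: (DP k) => + _; apply.
have D_1 k : \sum_(p <- D k) p.1 * p.2 = 1 by case: (DP k).
have fK : cancel f (graded_unmul gW gW' D) := graded_mulK D_mem D_1.
have unmulK : cancel (graded_unmul gW gW' D) f by apply: graded_unmulK.
exact: (@Bijective _ _ fL _ fK unmulK).
Qed.
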